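(* Every graph that admits an empty-ply drawing admits a $\frac14$-SHPED.
   Context: A straight-line drawing of a graph $G=(V,E)$ places each vertex at a distinct point of the plane and draws each edge as the straight-line segment between its endpoints. For each vertex $v$, the ply-disk $D_v$ is the open disk centered at $v$ with radius equal to half the length of the longest edge incident to $v$. A drawing is empty-ply if every ply-disk $D_v$ contains no vertex other than $v$ in its interior. A partial edge drawing (PED) of $G$ is a straight-line drawing in which each edge $e$ is divided into three segments, of which the middle part is not drawn and only the two segments incident to the endpoints (the stubs) are drawn, such that no two drawn stubs cross. A $\frac14$-SHPED is a PED in which, for every edge $e$, both stubs of $e$ have length equal to $\frac14$ of the length of $e$. *)

(* Defs.v *)
From HB Require Import structures.
From mathcomp Require Import all_boot all_order all_algebra.
From mathcomp Require Import all_classical all_reals.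

Set Implicit Arguments.
Unset Strict Implicit.
Unset Printing Implicit Defensive.

Import Order.TTheory GRing.Theory Num.Theory.

Local Open Scope classical_set_scope.
Local Open Scope ring_scope.

Definition simple_graph (T : finType) (e : rel T) : Prop :=
  symmetric e /\ irreflexive e.

Section Drawings.
Variables (R : realType) (T : finType) (e : rel T).

Local Notation plane := (R * R)%type.

(* Euclidean distance; the library norm on a product is the max norm. *)
Definition dist (x y : plane) : R :=
  Num.sqrt ((x.1 - y.1) ^+ 2 + (x.2 - y.2) ^+ 2).

Definition segment (a b : plane) : set plane :=
  [set x | exists2 t : R, 0 <= t <= 1 &
     x = (a.1 + t * (b.1 - a.1), a.2 + t * (b.2 - a.2))].

(* Edges are drawn as the segments between the images of their endpoints, so
   the drawing is determined by the vertex positions. *)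
Definition straight_line_drawing (p : T -> plane) : Prop := injective p.

(* An isolated vertex gets radius 0, hence an empty ply-disk. *)
Definition ply_radius (p : T -> plane) (v : T) : R :=
  (\big[Num.max/0]_(w | e v w) dist (p v) (p w)) / 2.

Definition ply_disk (p : T -> plane) (v : T) : set plane :=
  [set x | dist (p v) x < ply_radius p v].

Definition empty_ply_drawing (p : T -> plane) : Prop :=
  straight_line_drawing p /\
  forall v w : T, w <> v -> ~ ply_disk p v (p w).

(* [l u v] is the length of the stub at [u] of the edge [uv]; the other stub of
   the same edge, at [v], has length [l v u]. *)
Definition stub (p : T -> plane) (l : T -> T -> R) (u v : T) : set plane :=
  [set x | segment (p u) (p v) x /\ dist (p u) x <= l u v].

(* Two distinct stubs may share only the vertex to which both are attached;
   overlapping or touching otherwise counts as crossing. The pairs (u, v) and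
   (v, u) index the two stubs of one edge. *)
Definition noncrossing_stubs (p : T -> plane) (l : T -> T -> R) : Prop :=
  forall u v u' v' : T, e u v -> e u' v' -> (u, v) <> (u', v') ->
  forall x : plane, stub p l u v x -> stub p l u' v' x -> u = u' /\ x = p u.

Definition partial_edge_drawing (p : T -> plane) (l : T -> T -> R) : Prop :=
  [/\ straight_line_drawing p,
      forall u v, e u v -> 0 < l u v /\ l u v + l v u < dist (p u) (p v)
    & noncrossing_stubs p l].

Definition SHPED (delta : R) (p : T -> plane) : Prop :=
  exists2 l : T -> T -> R, partial_edge_drawing p l &
    forall u v, e u v -> l u v = delta * dist (p u) (p v).

End Drawings.

(* Main.v *)
Require Import Defs.
From HB Require Import structures.
From mathcomp Require Import all_boot all_order all_algebra.
From mathcomp Require Import all_classical all_reals.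
From mathcomp Require Import topology normedtype.
From mathcomp Require Import ring lra.
Import Order.TTheory GRing.Theory Num.Theory.
Import numFieldNormedType.Exports.
Local Open Scope ring_scope.

(** In an empty-ply drawing the two stubs attached to distinct vertices [u] and
    [u'] have total length at most [|uu'|], so they can only meet when they
    touch at the midpoint of [uu'], the four endpoints [v', u, u', v] being
    equally spaced on a line.  Two stubs attached to the same vertex [u] can
    only overlap when the nearer endpoint is the midpoint of the longer edge.
    Both degenerate cases do occur, so the vertices are moved by
    [x |-> x - eps |x - c|^2 (x - c)] for a small [eps > 0].  The cubic term has
    a negative third difference along every line, which pulls touching stubs
    apart, and it bends every line that avoids [c], which removes the overlaps
    once [c] is chosen off all lines through two vertices.  All other pairs of
    stubs satisfy strict inequalities that survive for small [eps]. *)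

Section PlaneGeometry.
Local Open Scope classical_set_scope.
Context {R : realType}.
Local Notation plane := (R * R)%type.
Implicit Types (x y z c : plane).

(** * Inner and cross products, and Euclidean distance *)

Definition dot x y : R := x.1 * y.1 + x.2 * y.2.

Definition cross x y : R := x.1 * y.2 - x.2 * y.1.

Definition pull c x : plane :=
  (dot (x - c) (x - c) * (c.1 - x.1), dot (x - c) (x - c) * (c.2 - x.2)).

Definition bend c (eps : R) x : plane :=
  (x.1 + eps * (pull c x).1, x.2 + eps * (pull c x).2).

Lemma dot_ge0 x : 0 <= dot x x.
Proof. by rewrite addr_ge0 // -expr2 sqr_ge0. Qed.

Lemma dot_eq0 x : dot x x = 0 -> x = 0.
Proof.
move/eqP; rewrite paddr_eq0 -?expr2 ?sqr_ge0 // !sqrf_eq0.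
by case: x => a b /= /andP[/eqP -> /eqP ->].
Qed.

Lemma dot_gt0 x : x != 0 -> 0 < dot x x.
Proof.
move=> x0; rewrite lt_neqAle dot_ge0 andbT eq_sym.
by apply: contra_neq x0 => /dot_eq0.
Qed.

Lemma dist_sqrt_dot x y : dist x y = Num.sqrt (dot (y - x) (y - x)).
Proof. by congr Num.sqrt; rewrite /dot /=; ring. Qed.

Lemma distC x y : dist x y = dist y x.
Proof. by congr Num.sqrt; ring. Qed.

Lemma dist_gt0 x y : x <> y -> 0 < dist x y.
Proof.
move=> xy; rewrite dist_sqrt_dot sqrtr_gt0 dot_gt0 // subr_eq0.
by apply/eqP => /esym.
Qed.

(** * Quadratics at small positive arguments, and a centre off all lines *)

Lemma near_quadratic_gt0 (a b d : R) :
  0 < a -> \forall t \near 0^'+, 0 < a + t * b + t ^+ 2 * d.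
Proof.
move=> a0; pose m := 1 + `|b| + `|d|.
(* For [0 < t < 1] the last two terms are together at least [- t * (m - 1)]; the summand 1 makes [m]
   a valid divisor. *)
have m0 : 0 < m by rewrite /m; have := normr_ge0 b; have := normr_ge0 d; lra.
near=> t.
have t0 : 0 < t by near: t; exact: nbhs_right_gt.
have t1 : t < 1 by near: t; exact: nbhs_right_lt.
have tm : t * m < a.
  by rewrite -ltr_pdivlMr //; near: t; apply: nbhs_right_lt; rewrite divr_gt0.
have hb : - (t * `|b|) <= t * b.
  by rewrite -mulrN ler_pM2l // lerNl -normrN ler_norm.
have hd : - (t * `|d|) <= t ^+ 2 * d.
  apply: (@le_trans _ _ (- (t ^+ 2 * `|d|))).
    by rewrite lerN2 ler_wpM2r // expr2; nra.
  by rewrite -mulrN ler_pM2l ?exprn_gt0 // lerNl -normrN ler_norm.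
by move: tm; rewrite /m; nra.
Unshelve. all: by end_near. Qed.

(** The lowest nonzero coefficient dominates; if the constant term vanishes, a factor [t] is split
    off. *)
Lemma near_quadratic_neq0 (a b d : R) :
  [|| a != 0, b != 0 | d != 0] ->
  \forall t \near 0^'+, a + t * b + t ^+ 2 * d != 0.
Proof.
have lead (a' b' d' : R) : a' != 0 ->
    \forall t \near 0^'+, a' + t * b' + t ^+ 2 * d' != 0.
  move=> a0; have [neg|pos|eq0] := ltgtP a' 0.
  - have := @near_quadratic_gt0 (- a') (- b') (- d').
    rewrite oppr_gt0 => /(_ neg); apply: filterS => t h.
    by apply: ltr0_neq0; lra.
  - by have := @near_quadratic_gt0 a' b' d' pos; apply: filterS => t /lt0r_neq0.
  - by rewrite eq0 eqxx in a0.
have [->|a0 _] := eqVneq a 0; last exact: lead.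
have [->|b0 _] := eqVneq b 0 => /=.
  move=> d0; near=> t.
  have t0 : 0 < t by near: t; exact: nbhs_right_gt.
  by rewrite add0r mulr0 add0r mulf_neq0 // expf_neq0 // gt_eqF.
near=> t.
have t0 : 0 < t by near: t; exact: nbhs_right_gt.
have -> : 0 + t * b + t ^+ 2 * d = t * (b + t * d + t ^+ 2 * 0) by ring.
apply: mulf_neq0; first by rewrite gt_eqF.
by near: t; exact: lead.
Unshelve. all: by end_near. Qed.

(* The point [(t, t ^ 2)] of the parabola lies on a given line for at most two
   values of [t]. *)
Lemma point_off_lines (T : finType) (p : T -> plane) :
  injective p ->
  exists c, forall u v, u != v -> cross (p v - p u) (p u - c) != 0.
Proof.
move=> pinj.
suff : \forall t \near 0^'+, forall uv : T * T, uv.1 != uv.2 ->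
    cross (p uv.2 - p uv.1) (p uv.1 - (t, t ^+ 2)) != 0.
  by case/filter_ex => t h; exists (t, t ^+ 2) => u v; exact: (h (u, v)).
apply: filter_forall => -[u v] /=.
have [->|uv] := eqVneq u v; first by apply: nearW => t; rewrite ?eqxx.
set d := p v - p u.
(* These are the coefficients of the cross product as a quadratic in [t]; if the last two vanish
   then [d = 0], against injectivity. *)
have : [|| cross d (p u) != 0, d.2 != 0 | - d.1 != 0].
  rewrite oppr_eq0 -implyNb negbK; apply/implyP => _.
  apply: contra_neqT uv; rewrite negb_or !negbK => /andP[/eqP d2 /eqP d1].
  apply/pinj/esym/subr0_eq.
  by rewrite -/d; move: d1 d2; case: (d) => ? ? /= -> ->.
move/near_quadratic_neq0; apply: filterS => t + _.
by congr (_ != _); rewrite /cross /=; ring.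
Qed.

(** * Stubs attached to distinct vertices *)

(* The four inequalities say that the bilinear function [(s, t) |->
   dot w (w - s a + t b)] is positive at the corners of [0, 1/4]^2. *)
Definition separated (w a b : plane) : Prop :=
  [/\ 0 < dot w w, dot w a < 4 * dot w w, - dot w b < 4 * dot w w &
      dot w a - dot w b < 4 * dot w w].

Lemma separated_stubs_disjoint (w a b : plane) (s t : R) :
  separated w a b -> 0 <= s <= 1 / 4 -> 0 <= t <= 1 / 4 ->
  w.1 = s * a.1 - t * b.1 -> w.2 = s * a.2 - t * b.2 -> False.
Proof.
move=> [h0 ha hb hab] /andP[s0 s1] /andP[t0 t1] e1 e2.
have : dot w w = s * dot w a - t * dot w b.
  by rewrite {1}/dot {2}e1 {2}e2 /dot; ring.
move: (dot w w) (dot w a) (dot w b) h0 ha hb hab => W A B h0 ha hb hab eW.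
(* These are the bilinear weights of the four corners, with sum 1/16. The weighted corner values sum
   to a multiple of [W - s * A + t * B = 0], yet to at least [m / 16]. *)
have k0 : 0 <= (1 / 4 - s) * (1 / 4 - t) by rewrite mulr_ge0 // subr_ge0.
have k1 : 0 <= s * (1 / 4 - t) by rewrite mulr_ge0 // subr_ge0.
have k2 : 0 <= (1 / 4 - s) * t by rewrite mulr_ge0 // subr_ge0.
have k3 : 0 <= s * t by rewrite mulr_ge0.
pose m := Num.min (Num.min (4 * W) (4 * W - A))
  (Num.min (4 * W + B) (4 * W - A + B)).
have m0 : 0 < m by rewrite !lt_min; lra.
have /andP[/andP[m1 m2] /andP[m3 m4]] :
    ((m <= 4 * W) && (m <= 4 * W - A)) &&
    ((m <= 4 * W + B) && (m <= 4 * W - A + B)).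
  by rewrite -!le_min.
have := ler_wpM2l k0 m1; have := ler_wpM2l k1 m2.
have := ler_wpM2l k2 m3; have := ler_wpM2l k3 m4.
by nra.
Qed.

(** Three of the four inequalities are already strict at [eps = 0] and persist. The fourth can be an
    equality only for equally spaced [y', x, x', y], where the term of first order in [eps]
    decides. *)
Lemma bend_separated c x y x' y' :
  x != x' ->
  dot (y - x) (y - x) <= 4 * dot (x' - x) (x' - x) ->
  dot (y' - x') (y' - x') <= 4 * dot (x' - x) (x' - x) ->
  \forall eps \near 0^'+,
    separated (bend c eps x' - bend c eps x) (bend c eps y - bend c eps x)
              (bend c eps y' - bend c eps x').
Proof.
move=> xx' leA leB.
pose q := pull c.
have bendE eps z z' : bend c eps z - bend c eps z' =
    ((z - z').1 + eps * (q z - q z').1, (z - z').2 + eps * (q z - q z').2).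
  by rewrite /bend /q /=; congr pair => /=; ring.
have expand (eps : R) (a a' b b' : plane) :
    dot (a.1 + eps * a'.1, a.2 + eps * a'.2) (b.1 + eps * b'.1, b.2 + eps * b'.2) =
    dot a b + eps * (dot a b' + dot a' b) + eps ^+ 2 * dot a' b'.
  by rewrite /dot /=; ring.
set w := x' - x in leA leB *; set a := y - x in leA *; set b := y' - x' in leB *.
have w0 : 0 < dot w w by apply: dot_gt0; rewrite subr_eq0 eq_sym.
(* Since |2w - a|^2 and |2w + b|^2 are nonnegative, the length bounds give w.a <= 2|w|^2 and -w.b <=
   2|w|^2, with both equalities only if a = 2w and b = -2w. *)
pose a2 : plane := (2 * w.1 - a.1, 2 * w.2 - a.2).
pose b2 : plane := (2 * w.1 + b.1, 2 * w.2 + b.2).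
have a2E : dot a2 a2 = 4 * dot w w - 4 * dot w a + dot a a by rewrite /dot /=; ring.
have b2E : dot b2 b2 = 4 * dot w w + 4 * dot w b + dot b b by rewrite /dot /=; ring.
have a2_ge0 := dot_ge0 a2; have b2_ge0 := dot_ge0 b2.
have lin (k l : R) : 0 < 4 * dot w w + k * dot w a + l * dot w b ->
    \forall eps \near 0^'+,
      let w' := bend c eps x' - bend c eps x in
      0 < 4 * dot w' w' + k * dot w' (bend c eps y - bend c eps x) +
          l * dot w' (bend c eps y' - bend c eps x').
  move=> pos; set wq := q x' - q x; set aq := q y - q x; set bq := q y' - q x'.
  have := @near_quadratic_gt0 _ (4 * (dot w wq + dot wq w) +
     k * (dot w aq + dot wq a) + l * (dot w bq + dot wq b))
     (4 * dot wq wq + k * dot wq aq + l * dot wq bq) pos.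
  apply: filterS => eps; congr (0 < _).
  by rewrite /= !bendE -/w -/a -/b -/wq -/aq -/bq !expand; ring.
have touch : \forall eps \near 0^'+,
   let w' := bend c eps x' - bend c eps x in
   0 < 4 * dot w' w' + (-1) * dot w' (bend c eps y - bend c eps x) +
       1 * dot w' (bend c eps y' - bend c eps x').
  have [|le0] := ltP 0 (4 * dot w w + (-1) * dot w a + 1 * dot w b).
    exact: lin.
  have /dot_eq0[a21 a22] : dot a2 a2 = 0 by lra.
  have /dot_eq0[b21 b22] : dot b2 b2 = 0 by lra.
  (* This factor is the inner product of the bent [w] with [w] itself. *)
  have := @near_quadratic_gt0 (dot w w) (dot (q x' - q x) w) 0 w0.
  move=> near_w; near=> eps => /=.
  have eps0 : 0 < eps by near: eps; exact: nbhs_right_gt.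
  have ew : 0 < dot w w + eps * dot (q x' - q x) w + eps ^+ 2 * 0 by near: eps.
  have y1 : y.1 = x.1 + 2 * w.1 by move: a21; rewrite /a /=; lra.
  have y2 : y.2 = x.2 + 2 * w.2 by move: a22; rewrite /a /=; lra.
  have z1 : y'.1 = x.1 - w.1 by move: b21; rewrite /b /w /=; lra.
  have z2 : y'.2 = x.2 - w.2 by move: b22; rewrite /b /w /=; lra.
  have u1 : x'.1 = x.1 + w.1 by rewrite /w /=; lra.
  have u2 : x'.2 = x.2 + w.2 by rewrite /w /=; lra.
  (* [6 |w|^2 w] is the third difference of [|z - c|^2 (z - c)] along
     [y', x, x', y]. *)
  suff -> : 4 * dot (bend c eps x' - bend c eps x) (bend c eps x' - bend c eps x) +
      -1 * dot (bend c eps x' - bend c eps x) (bend c eps y - bend c eps x) +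
      1 * dot (bend c eps x' - bend c eps x) (bend c eps y' - bend c eps x') =
      6 * eps * dot w w * (dot w w + eps * dot (q x' - q x) w + eps ^+ 2 * 0).
    by rewrite !mulr_gt0.
  rewrite /bend /q /pull /dot /= y1 y2 z1 z2 u1 u2; move: (w.1) (w.2) => w1 w2.
  by ring.
near=> eps; split.
- have /= : let w' := bend c eps x' - bend c eps x in
    0 < 4 * dot w' w' + 0 * dot w' (bend c eps y - bend c eps x) +
       0 * dot w' (bend c eps y' - bend c eps x') by near: eps; apply: lin; lra.
  by lra.
- have /= : let w' := bend c eps x' - bend c eps x in
    0 < 4 * dot w' w' + -1 * dot w' (bend c eps y - bend c eps x) +
       0 * dot w' (bend c eps y' - bend c eps x') by near: eps; apply: lin; lra.
  by lra.
- have /= : let w' := bend c eps x' - bend c eps x in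
    0 < 4 * dot w' w' + 0 * dot w' (bend c eps y - bend c eps x) +
       1 * dot w' (bend c eps y' - bend c eps x') by near: eps; apply: lin; lra.
  by lra.
- have /= : let w' := bend c eps x' - bend c eps x in
    0 < 4 * dot w' w' + -1 * dot w' (bend c eps y - bend c eps x) +
       1 * dot w' (bend c eps y' - bend c eps x') by near: eps.
  by lra.
Unshelve. all: by end_near. Qed.

(** * Stubs attached to a common vertex *)

(** On a common ray |b - a| = |b| - |a|, so |b| <= 2|b - a| forces |b| >= 2|a|, and the other bound
    is the converse. The argument uses squared lengths to avoid roots. *)
Lemma codirectional_half (a b : plane) :
  cross a b = 0 -> 0 < dot a b -> dot a a <= dot b b ->
  dot b b <= 4 * dot a a -> dot b b <= 4 * dot (b - a) (b - a) ->
  b = (2 * a.1, 2 * a.2).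
Proof.
move=> ab0 ab_gt0 le_ab le_b4a le_b4ba.
have lagrange : dot a b ^+ 2 = dot a a * dot b b.
  have -> : dot a a * dot b b = dot a b ^+ 2 + cross a b ^+ 2.
    by rewrite /dot /cross; ring.
  by rewrite ab0; ring.
have baE : dot (b - a) (b - a) = dot b b - 2 * dot a b + dot a a.
  by rewrite /dot /=; ring.
pose d : plane := (b.1 - 2 * a.1, b.2 - 2 * a.2).
have dE : dot d d = dot b b - 4 * dot a b + 4 * dot a a.
  by rewrite /dot /=; ring.
suff /dot_eq0[] : dot d d = 0.
  by case: (b) => b1 b2 /= h1 h2; congr pair; lra.
have := dot_ge0 d; have a_ge0 := dot_ge0 a.
rewrite {}dE; move: le_b4ba; rewrite {}baE => le8.
move: (dot a a) (dot b b) (dot a b) ab_gt0 le_ab le_b4a lagrange le8 a_ge0.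
move=> A B D D0 AB BA DE le8 A0 _.
have A1 : 0 < A by rewrite lt_neqAle A0 andbT; apply: contraTneq D0 => A00; nra.
(* Squaring [8 * D <= 4 * A + 3 * B] and inserting D^2 = AB leaves a quadratic form that factors. *)
have prod : 0 <= (4 * A - 9 * B) * (4 * A - B).
  have : (8 * D) ^+ 2 <= (4 * A + 3 * B) ^+ 2 by rewrite ler_sqr ?nnegrE; lra.
  by rewrite exprMn DE; lra.
have neg : 4 * A - 9 * B < 0 by lra.
have BE : B = 4 * A by move: prod; rewrite nmulr_rge0 //; lra.
have DA : (D - 2 * A) * (D + 2 * A) = 0 by move: DE; rewrite BE; lra.
have DA0 : D + 2 * A != 0 by apply: lt0r_neq0; lra.
by move/eqP: DA; rewrite mulf_eq0 (negPf DA0) orbF => /eqP; lra.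
Qed.

(** The cross product is quadratic in [eps]. If [y] is the midpoint of [x] and [z], its constant
    term vanishes, but the coefficient [B] of [eps] is nonzero because [c] is off the line. *)
Lemma near_bend_cross_neq0 c x y z :
  (cross (y - x) (z - x) != 0 \/
   z - x = (2 * (y - x).1, 2 * (y - x).2) /\ cross (y - x) (x - c) != 0) ->
  \forall eps \near 0^'+,
    cross (bend c eps y - bend c eps x) (bend c eps z - bend c eps x) != 0.
Proof.
pose q := pull c.
pose B := cross (y - x) (q z - q x) + cross (q y - q x) (z - x).
move=> hyp; have : [|| cross (y - x) (z - x) != 0, B != 0
                    | cross (q y - q x) (q z - q x) != 0].
  case: hyp => [->//|[[z1 z2] yc]]; apply/or3P/Or32.
  have {}z1 : z.1 = x.1 + 2 * (y - x).1 by rewrite -z1 /=; ring.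
  have {}z2 : z.2 = x.2 + 2 * (y - x).2 by rewrite -z2 /=; ring.
  have y1 : y.1 = x.1 + (y - x).1 by rewrite /=; ring.
  have y2 : y.2 = x.2 + (y - x).2 by rewrite /=; ring.
  have -> : B = - 2 * dot (y - x) (y - x) * cross (y - x) (x - c).
    rewrite /B; move: (y - x) z1 z2 y1 y2 => d z1 z2 y1 y2.
    by rewrite /cross /q /pull /dot /= z1 z2 y1 y2; ring.
  rewrite !mulf_neq0 ?oppr_eq0 ?pnatr_eq0 //; apply: contra_neq yc => /dot_eq0 ->.
  by rewrite /cross /=; ring.
move/near_quadratic_neq0; apply: filterS => eps; congr (_ != 0).
by rewrite /B /cross /bend /q /=; ring.
Qed.

(** The bounds are the empty-ply condition at [x] (twice), [y] and [z]. Non-parallel and opposite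
    directions survive small [eps]; for equal directions the nearer endpoint is a midpoint and the
    line gets bent. *)
Lemma bend_not_codirectional c x y z :
  cross (y - x) (x - c) != 0 ->
  dot (y - x) (y - x) <= 4 * dot (z - x) (z - x) ->
  dot (z - x) (z - x) <= 4 * dot (y - x) (y - x) ->
  dot (y - x) (y - x) <= 4 * dot (z - y) (z - y) ->
  dot (z - x) (z - x) <= 4 * dot (z - y) (z - y) ->
  \forall eps \near 0^'+,
    cross (bend c eps y - bend c eps x) (bend c eps z - bend c eps x) != 0 \/
    dot (bend c eps y - bend c eps x) (bend c eps z - bend c eps x) < 0.
Proof.
move=> yc le_yz le_zy le_y le_z.
have crossC (a b : plane) : cross a b = - cross b a by rewrite /cross; ring.
have [yz0|yz0] := eqVneq (cross (y - x) (z - x)) 0; last first.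
  by have := @near_bend_cross_neq0 c x y z (or_introl yz0); apply: filterS; left.
have [neg|pos|dot0] := ltgtP (dot (y - x) (z - x)) 0.
- pose q := pull c.
  have := @near_quadratic_gt0 (- dot (y - x) (z - x))
     (- (dot (y - x) (q z - q x) + dot (q y - q x) (z - x)))
     (- dot (q y - q x) (q z - q x)).
  rewrite oppr_gt0 => /(_ neg); apply: filterS => eps h; right.
  rewrite -oppr_gt0; move: h; congr (0 < _).
  by rewrite /bend /q /dot /=; ring.
- have [le_yz1|/ltW le_zy1] := leP (dot (y - x) (y - x)) (dot (z - x) (z - x)).
    have zE : z - x = (2 * (y - x).1, 2 * (y - x).2).
      apply: codirectional_half => //.
      by have -> : z - x - (y - x) = z - y by rewrite opprB addrA subrK.
    have := @near_bend_cross_neq0 c x y z (or_intror (conj zE yc)).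
    by apply: filterS => eps; left.
  have yE : y - x = (2 * (z - x).1, 2 * (z - x).2).
    apply: codirectional_half => //.
    - by rewrite crossC yz0 oppr0.
    - by move: pos; congr (0 < _); rewrite /dot; ring.
    - have -> : y - x - (z - x) = - (z - y) by rewrite !opprB addrA subrK.
      by move: le_y; congr (_ <= 4 * _); rewrite /dot /=; ring.
  have zc : cross (z - x) (x - c) != 0.
    apply: contra_neq yc => zc; rewrite yE.
    have -> : cross (2 * (z - x).1, 2 * (z - x).2) (x - c) =
        2 * cross (z - x) (x - c).
      by rewrite /cross /=; ring.
    by rewrite zc mulr0.
  have := @near_bend_cross_neq0 c x z y (or_intror (conj yE zc)).
  by apply: filterS => eps h; left; rewrite crossC oppr_eq0.
(* By Lagrange's identity one of the two vectors is zero, hence [y = x], which contradicts the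
   choice of [c]. *)
- have : dot (y - x) (y - x) * dot (z - x) (z - x) =
         dot (y - x) (z - x) ^+ 2 + cross (y - x) (z - x) ^+ 2.
    by rewrite /dot /cross; ring.
  rewrite dot0 yz0 expr0n addr0 => /eqP; rewrite mulf_eq0 => yz.
  have : dot (y - x) (y - x) = 0.
    case/orP: yz => /eqP // z0; apply/eqP; rewrite eq_le dot_ge0 andbT.
    by rewrite z0 mulr0 in le_yz.
  move/dot_eq0 => y0; move: yc; rewrite y0 /cross /= => /eqP[]; ring.
Qed.

End PlaneGeometry.

(** * From empty-ply drawings to quarter stubs *)

Section Drawings.
Local Open Scope classical_set_scope.
Context {R : realType} {T : finType} {e : rel T}.
Implicit Types (p : T -> R * R).

Lemma empty_ply_dot p u v w :
  empty_ply_drawing e p -> e u v -> w <> u ->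
  dot (p v - p u) (p v - p u) <= 4 * dot (p w - p u) (p w - p u).
Proof.
move=> [_ empty] uv wu.
have /negP := empty u w wu; rewrite /ply_disk /= -leNgt => le_rad.
have le_max : dist (p u) (p v) <= \big[Num.max/0]_(w | e u w) dist (p u) (p w).
  exact: le_bigmax_cond.
have : dist (p u) (p v) <= 2 * dist (p u) (p w).
  by move: le_rad; rewrite /ply_radius; lra.
rewrite -ler_sqr ?nnegrE ?mulr_ge0 ?sqrtr_ge0 // exprMn !dist_sqrt_dot.
by rewrite !sqr_sqrtr ?dot_ge0 // -natrX.
Qed.

Lemma quarter_stubP p l u v x :
  p u <> p v -> l u v = 1 / 4 * dist (p u) (p v) -> stub p l u v x ->
  exists2 t : R, 0 <= t <= 1 / 4 &
    x = ((p u).1 + t * ((p v).1 - (p u).1), (p u).2 + t * ((p v).2 - (p u).2)).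
Proof.
move=> uv luv [[t /andP[t0 t1] xE] le_x]; exists t => //; rewrite t0 /=.
have dx : dist (p u) x = t * dist (p u) (p v).
  rewrite !dist_sqrt_dot -[in RHS](ger0_norm t0) -sqrtr_sqr -sqrtrM ?sqr_ge0 //.
  by congr Num.sqrt; rewrite xE /dot /=; ring.
by move: le_x; rewrite dx luv ler_pM2r // dist_gt0.
Qed.

Lemma quarter_SHPED p :
  simple_graph e -> injective p ->
  (forall u v u' v', e u v -> e u' v' -> u != u' ->
     separated (p u' - p u) (p v - p u) (p v' - p u')) ->
  (forall u v v', e u v -> e u v' -> v != v' ->
     cross (p v - p u) (p v' - p u) != 0 \/ dot (p v - p u) (p v' - p u) < 0) ->
  SHPED e (1 / 4) p.
Proof.
move=> [esym eirr] pinj sep cod.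
have pneq u v : e u v -> p u <> p v.
  by move=> uv /pinj uE; rewrite uE eirr in uv.
exists (fun u v => 1 / 4 * dist (p u) (p v)) => //; split=> //.
  move=> u v /pneq /dist_gt0 uv; rewrite [dist (p v) _]distC; lra.
move=> u v u' v' uv uv' neq x.
case/(quarter_stubP _ _ _ _ _ (pneq _ _ uv)) => // s s14 ->.
case/(quarter_stubP _ _ _ _ _ (pneq _ _ uv')) => // t t14 [].
have [uu'|uu'] := eqVneq u u' => eq1 eq2; last first.
  have suu' := sep _ _ _ _ uv uv' uu'.
  by case: (separated_stubs_disjoint _ _ _ _ _ suu' s14 t14) => /=; lra.
subst u'; split=> //; have vv' : v != v' by apply: contra_not_neq neq => ->.
suff -> : s = 0 by rewrite !mul0r !addr0 -surjective_pairing.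
have {}eq1 : s * (p v - p u).1 = t * (p v' - p u).1 by move: eq1 => /=; lra.
have {}eq2 : s * (p v - p u).2 = t * (p v' - p u).2 by move: eq2 => /=; lra.
(* The vectors [s * (p v - p u)] and [t * (p v' - p u)] agree. Their cross product with [p v' - p u]
   is zero and their inner product with it is nonnegative; either one forces [s = 0]. *)
case: (cod _ _ _ uv uv' vv') => [cross0|dot0].
  have : s * cross (p v - p u) (p v' - p u) = 0.
    by rewrite /cross mulrBr !mulrA eq1 eq2; ring.
  by move/eqP; rewrite mulf_eq0 (negPf cross0) orbF => /eqP.
have : s * dot (p v - p u) (p v' - p u) = t * dot (p v' - p u) (p v' - p u).
  by rewrite /dot mulrDr !mulrA eq1 eq2; ring.
have /andP[s0 _] := s14; have /andP[t0 _] := t14 => sE.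
apply/eqP; rewrite eq_le s0 andbT -(nmulr_lge0 _ dot0) sE.
by rewrite mulr_ge0 // dot_ge0.
Qed.

(** Only finitely many tuples of vertices occur, so all conditions hold for a common range of small
    [eps]. *)
Lemma near_bend_SHPED c p :
  simple_graph e -> empty_ply_drawing e p ->
  (forall u v, u != v -> cross (p v - p u) (p u - c) != 0) ->
  \forall eps \near 0^'+, SHPED e (1 / 4) (bend c eps \o p).
Proof.
move=> simple ply off; have [esym eirr] := simple; have [pinj _] := ply.
have dotC x y : dot (x - y) (x - y) = dot (y - x) (y - x) :> R.
  by rewrite /dot /=; ring.
have pneq u v : u != v -> p u != p v by apply: contra_neq => /pinj.
have enq u v : e u v -> u != v by apply: contraTneq => ->; rewrite eirr.
have near_inj : \forall eps \near 0^'+, forall uu' : T * T, uu'.1 != uu'.2 ->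
    bend c eps (p uu'.1) <> bend c eps (p uu'.2).
  apply: filter_forall => -[u u'] /=.
  have [->|uu'] := eqVneq u u'; first by apply: nearW.
  (* With degenerate stubs ([y = x], [y' = x']) the first inequality of [separated] says that the
     bent points differ. *)
  have /= := @bend_separated R c (p u) (p u) (p u') (p u') (pneq _ _ uu').
  rewrite !subrr.
  have dot00 : dot (0 : R * R) 0 = 0 by rewrite /dot /=; ring.
  rewrite dot00 mulr_ge0 ?dot_ge0 // => /(_ isT isT).
  apply: filterS => eps [+ _ _ _] _ eq_bend.
  by rewrite eq_bend subrr dot00 ltxx.
have near_sep : \forall eps \near 0^'+, forall q : T * T * (T * T),
    e q.1.1 q.1.2 -> e q.2.1 q.2.2 -> q.1.1 != q.2.1 ->
    separated (bend c eps (p q.2.1) - bend c eps (p q.1.1))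
      (bend c eps (p q.1.2) - bend c eps (p q.1.1))
      (bend c eps (p q.2.2) - bend c eps (p q.2.1)).
  apply: filter_forall => -[[u v] [u' v']] /=.
  have [uv|] := boolP (e u v); last by move=> _; apply: nearW.
  have [uv'|] := boolP (e u' v'); last by move=> _; apply: nearW.
  have [->|uu'] := eqVneq u u'; first by apply: nearW.
  apply: filterS (@bend_separated R c (p u) (p v) (p u') (p v') (pneq _ _ uu') _ _).
  - by move=> eps sep _ _ _.
  - by apply: (empty_ply_dot _ _ _ _ ply uv); apply/eqP; rewrite eq_sym.
  - rewrite [dot (p u' - p u) _]dotC.
    by apply: (empty_ply_dot _ _ _ _ ply uv'); apply/eqP.
have near_cod : \forall eps \near 0^'+, forall q : T * (T * T),
    e q.1 q.2.1 -> e q.1 q.2.2 -> q.2.1 != q.2.2 ->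
    let b x := bend c eps (p x) in
    cross (b q.2.1 - b q.1) (b q.2.2 - b q.1) != 0 \/
    dot (b q.2.1 - b q.1) (b q.2.2 - b q.1) < 0.
  apply: filter_forall => -[u [v v']] /=.
  have [uv|] := boolP (e u v); last by move=> _; apply: nearW.
  have [uv'|] := boolP (e u v'); last by move=> _; apply: nearW.
  have [->|vv'] := eqVneq v v'; first by apply: nearW.
  have vu : v <> u by apply/eqP; rewrite eq_sym enq.
  have v'u : v' <> u by apply/eqP; rewrite eq_sym enq.
  have off_uv := off _ _ (enq _ _ uv).
  apply: filterS (@bend_not_codirectional R c (p u) (p v) (p v') off_uv _ _ _ _).
  - by move=> eps cod _ _ _.
  - exact: (empty_ply_dot _ _ _ _ ply uv).
  - exact: (empty_ply_dot _ _ _ _ ply uv').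
  - rewrite [dot (p v - p u) _]dotC; apply: (empty_ply_dot _ _ _ _ ply).
      by rewrite esym.
    by apply/eqP; rewrite eq_sym.
  - rewrite [dot (p v' - p u) _]dotC [dot (p v' - p v) _]dotC.
    apply: (empty_ply_dot _ _ _ _ ply); first by rewrite esym.
    exact/eqP.
apply: filterS (filterI near_inj (filterI near_sep near_cod)).
move=> eps [inj [sep cod]]; apply: quarter_SHPED => //.
- move=> u v eq_uv; apply/eqP/contraT => uv.
  by case: (inj (u, v) uv).
- by move=> u v u' v'; exact: (sep (u, v, (u', v'))).
- by move=> u v v'; exact: (cod (u, (v, v'))).
Qed.

End Drawings.

Theorem theorem2 (R : realType) (T : finType) (e : rel T) :
  simple_graph e ->
  (exists p : T -> R * R, empty_ply_drawing e p) ->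
  exists p : T -> R * R, SHPED e (1 / 4) p.
Proof.
move=> simple [p ply]; have [pinj _] := ply.
have [c off] := point_off_lines _ p pinj.
have near_shped := near_bend_SHPED c p simple ply off.
have [eps shped] := @filter_ex _ _ (at_right_proper_filter 0) _ near_shped.
by exists (bend c eps \o p).
Qed.
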